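(* Let $\xi>0$, $\delta>0$, let $\mathcal{C}:\mathbb{R}^2\times S^1\to[\delta,\infty)$ be a continuously differentiable cost function, let $\mathbf{p}_0=((0,0),(1,0))$, and let $d_{\mathrm{c}}$ and $d_{\mathrm{proj}}$ be the associated maps on $(\mathbb{R}^2\times P^1)\times(\mathbb{R}^2\times P^1)$ defined in the context. Then both $d_{\mathrm{c}}$ and $d_{\mathrm{proj}}$ are globally controllable (i.e. they take finite values for every pair of points of $\mathbb{R}^2\times P^1$), but $d_{\mathrm{c}}$ is not locally controllable, as it has the property $$\limsup_{[\mathbf{p}]\to[\mathbf{p}_0]}d_{\mathrm{c}}([\mathbf{p}],[\mathbf{p}_0])\ \ge\ \pi\delta.$$
   Context: Projective line bundle. $P^1=S^1/\sim$ with $\mathbf{n}_1\sim\mathbf{n}_2\iff\mathbf{n}_1=\pm\mathbf{n}_2$. For $\mathbf{p}=(\mathbf{x},\mathbf{n})\in\mathbb{R}^2\times S^1$ put $\overline{\mathbf{p}}=(\mathbf{x},-\mathbf{n})$; the corresponding point of $\mathbb{R}^2\times P^1$ is the class $[\mathbf{p}]=\{\mathbf{p},\overline{\mathbf{p}}\}$. Curves and controls. For $\mathbf{q}_0,\mathbf{q}_1\in\mathbb{R}^2\times S^1$, $\Gamma_0(\mathbf{q}_0,\mathbf{q}_1)$ is the set of piecewise $C^1$ curves $\gamma=(\mathbf{x},\mathbf{n}):[0,1]\to\mathbb{R}^2\times S^1$ with $\gamma(0)=\mathbf{q}_0$, $\gamma(1)=\mathbf{q}_1$ and $\dot{\mathbf{x}}\in\mathrm{span}\{\mathbf{n}\}$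 a.e. $\Gamma_0^+(\mathbf{q}_0,\mathbf{q}_1)$ is the subset of those with $\dot{\mathbf{x}}\cdot\mathbf{n}\ge0$ a.e. Writing $\mathbf{n}(t)=(\cos\theta(t),\sin\theta(t))$, the controls are $u^1=\dot{\mathbf{x}}\cdot\mathbf{n}$ and $u^3=\dot\theta$. Length and distances. $L(\gamma)=\int_0^1\mathcal{C}(\gamma(t))\sqrt{\xi^2|u^1(t)|^2+|u^3(t)|^2}\,dt$, $d_{\mathcal{F}_0}(\mathbf{q}_0,\mathbf{q}_1)=\inf_{\gamma\in\Gamma_0(\mathbf{q}_0,\mathbf{q}_1)}L(\gamma)$ and $d_{\mathcal{F}_0^+}(\mathbf{q}_0,\mathbf{q}_1)=\inf_{\gamma\in\Gamma_0^+(\mathbf{q}_0,\mathbf{q}_1)}L(\gamma)$. On $\mathbb{R}^2\times P^1$ define $$d_{\mathrm{c}}([\mathbf{p}],[\mathbf{q}])=\min_{\mathbf{q}_0\in[\mathbf{p}],\,\mathbf{q}_1\in[\mathbf{q}]}d_{\mathcal{F}_0^+}(\mathbf{q}_0,\mathbf{q}_1),\qquad d_{\mathrm{proj}}([\mathbf{p}],[\mathbf{q}])=\min_{\mathbf{q}_0\in[\mathbf{p}],\,\mathbf{q}_1\in[\mathbf{q}]}d_{\mathcal{F}_0}(\mathbf{q}_0,\mathbf{q}_1).$$ Local controllability of $d$ at $[\mathbf{p}_0]$ means $\limsup_{[\mathbf{p}]\to[\mathbf{p}_0]}d([\mathbf{p}],[\mathbf{p}_0])=0$, where convergence is in the usual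 (quotient) topology of $\mathbb{R}^2\times P^1$. *)

(* Defs.v *)
From HB Require Import structures.
From mathcomp Require Import all_boot all_order all_algebra.
From mathcomp Require Import all_classical all_reals all_analysis.
From mathcomp Require Import ring lra.

Set Implicit Arguments.
Unset Strict Implicit.
Unset Printing Implicit Defensive.

Import Order.TTheory GRing.Theory Num.Theory.
Import numFieldNormedType.Exports.

Local Open Scope classical_set_scope.
Local Open Scope ring_scope.
Local Open Scope quotient_scope.

(* The library norm on 'rV[R]_2 is the sup norm, so Euclidean notions go      *)
(* through dot; topology and derivatives do not depend on the norm.           *)
Definition dot (R : realType) (u v : 'rV[R]_2) : R := \sum_i u 0 i * v 0 i.

Lemma dotE (R : realType) (u v : 'rV[R]_2) :
  dot u v = u 0 0 * v 0 0 + u 0 1 * v 0 1.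
Proof.
rewrite /dot !big_ord_recl big_ord0 addr0.
by congr (_ + u 0 _ * v 0 _); apply/val_inj.
Qed.

Definition direction (R : realType) (theta : R) : 'rV[R]_2 :=
  \row_i (if i == 0 then cos theta else sin theta).

(* set_type carries the topology induced from 'rV[R]_2.                       *)
Notation circle R := (set_type [set v : 'rV[R]_2 | dot v v = 1]).

Lemma dot_direction (R : realType) (theta : R) :
  direction theta \in [set v : 'rV[R]_2 | dot v v = 1].
Proof. by rewrite inE/= dotE !mxE/= -!expr2 cos2Dsin2. Qed.

Definition circle_point (R : realType) (theta : R) : circle R :=
  SigSub (dot_direction theta).

Lemma dot_antipode (R : realType) (u : circle R) :
  - \val u \in [set v : 'rV[R]_2 | dot v v = 1].
Proof. by have := valP u; rewrite !inE/= !dotE !mxE !mulrNN. Qed.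

Definition antipode (R : realType) (u : circle R) : circle R :=
  SigSub (dot_antipode u).

Lemma antipodeK (R : realType) : involutive (@antipode R).
Proof. by move=> u; apply/val_inj; rewrite /= opprK. Qed.

Definition antipodal (R : realType) : rel (circle R) :=
  fun u v => (u == v) || (u == antipode v).

Lemma antipodal_refl (R : realType) : reflexive (@antipodal R).
Proof. by move=> u; rewrite /antipodal eqxx. Qed.

Lemma antipodal_sym (R : realType) : symmetric (@antipodal R).
Proof.
move=> u v; rewrite /antipodal eq_sym; congr (_ || _).
by rewrite -(inj_eq (inv_inj (@antipodeK R))) antipodeK eq_sym.
Qed.

Lemma antipodal_trans (R : realType) : transitive (@antipodal R).
Proof.
move=> v u w /orP[]/eqP-> // /orP[]/eqP->; rewrite /antipodal ?antipodeK eqxx //.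
by rewrite orbT.
Qed.

Canonical antipodal_equiv (R : realType) :=
  EquivRel (@antipodal R) (@antipodal_refl R) (@antipodal_sym R)
    (@antipodal_trans R).

Notation projline R := (quotient_topology {eq_quot antipodal_equiv R}%qT).

Notation pose R := ('rV[R]_2 * circle R)%type.
Notation projpose R := ('rV[R]_2 * projline R)%type.

Definition flip (R : realType) (p : pose R) : pose R := (p.1, antipode p.2).

Definition pose_class (R : realType) (p : pose R) : projpose R :=
  (p.1, \pi_(projline R) p.2).

Definition pose_repr (R : realType) (P : projpose R) : pose R :=
  (P.1, repr P.2).

Lemma east_subproof (R : realType) :
  delta_mx 0 0 \in [set v : 'rV[R]_2 | dot v v = 1].
Proof. by rewrite inE/= dotE !mxE/= mulr1 mulr0 addr0. Qed.

Definition reference_pose (R : realType) : pose R :=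
  (0, SigSub (east_subproof R)).

(* theta |-> (cos theta, sin theta) is a local diffeomorphism onto the        *)
(* circle, so smoothness on the manifold is smoothness in (x, theta).         *)
Definition C1_cost (R : realType) (C : pose R -> R) : Prop :=
  let c := fun z : 'rV[R]_2 * R => C (z.1, circle_point z.2) in
  (forall z, differentiable c z) /\ (forall v, continuous ('D_v c)).

(* C^1 up to the endpoints: the derivative on the open interval extends       *)
(* continuously to the closed one.                                            *)
Definition C1_on (R : realType) (V : normedModType R) (f : R -> V) (a b : R) :
    Prop :=
  {within `[a, b], continuous f} /\
  exists2 g : R -> V, {within `[a, b], continuous g} &
    {in `]a, b[, forall t : R, is_derive t 1 f (g t)}.

(* A curve on [0, 1] is a total function whose other values are irrelevant.   *)
Definition piecewise_C1 (R : realType) (gamma : R -> pose R) : Prop :=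
  {within `[0, 1], continuous gamma} /\
  exists2 s : seq R, itv_partition 0 1 s &
    forall i, (i < size s)%N ->
      C1_on (fun t => (gamma t).1) (nth 1 (0 :: s) i) (nth 1 (0 :: s) i.+1) /\
      C1_on (fun t => \val (gamma t).2)
        (nth 1 (0 :: s) i) (nth 1 (0 :: s) i.+1).

Definition velocity (R : realType) (gamma : R -> pose R) : R -> 'rV[R]_2 :=
  derive1 (fun t => (gamma t).1).

Definition heading (R : realType) (gamma : R -> pose R) (t : R) : 'rV[R]_2 :=
  \val (gamma t).2.

Definition control1 (R : realType) (gamma : R -> pose R) (t : R) : R :=
  dot (velocity gamma t) (heading gamma t).

(* The derivative at t of an angle function of the heading near t; control3E  *)
(* shows that it exists and does not depend on the angle function.            *)
Definition control3 (R : realType) (gamma : R -> pose R) (t : R) : R :=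
  xget 0 [set w | exists2 theta : R -> R,
      \forall s \near t, heading gamma s = direction (theta s) &
      is_derive t 1 theta w].

Definition admissible (R : realType) (p q : pose R) : set (R -> pose R) :=
  [set gamma | [/\ piecewise_C1 gamma, gamma 0 = p, gamma 1 = q &
    {ae @lebesgue_measure R, forall t : R, t \in `[0, 1] ->
      velocity gamma t \in <[heading gamma t]>%VS}]].

Definition admissible_forward (R : realType) (p q : pose R) :
    set (R -> pose R) :=
  [set gamma | admissible p q gamma /\
    {ae @lebesgue_measure R, forall t : R, t \in `[0, 1] ->
      0 <= dot (velocity gamma t) (heading gamma t)}].

Section distances.
Variables (R : realType) (xi : R) (C : pose R -> R).
Local Open Scope ereal_scope.

Definition curve_length (gamma : R -> pose R) : \bar R :=
  \int[@lebesgue_measure R]_(t in `[0%R, 1%R])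
    (C (gamma t) * Num.sqrt (xi ^+ 2 * `|control1 gamma t| ^+ 2 +
                             `|control3 gamma t| ^+ 2))%:E.

Definition dist_F0 (p q : pose R) : \bar R :=
  ereal_inf [set curve_length gamma | gamma in admissible p q].

Definition dist_F0_forward (p q : pose R) : \bar R :=
  ereal_inf [set curve_length gamma | gamma in admissible_forward p q].

Definition class_min (d : pose R -> pose R -> \bar R) (P Q : projpose R) :
    \bar R :=
  let p := pose_repr P in let q := pose_repr Q in
  Order.min (Order.min (d p q) (d p (flip q)))
            (Order.min (d (flip p) q) (d (flip p) (flip q))).

Definition dist_c : projpose R -> projpose R -> \bar R :=
  class_min dist_F0_forward.

Definition dist_proj : projpose R -> projpose R -> \bar R := class_min dist_F0.

End distances.

Definition globally_controllable (R : realType)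
    (d : projpose R -> projpose R -> \bar R) : Prop :=
  forall P Q, d P Q \is a fin_num.

(* The limsup is over P != P0.                                               *)
Definition locally_controllable (R : realType)
    (d : projpose R -> projpose R -> \bar R) (P0 : projpose R) : Prop :=
  limf_esup (d^~ P0) P0^' = 0%E.

Lemma flipK (R : realType) : involutive (@flip R).
Proof. by move=> [x u]; rewrite /flip/= antipodeK. Qed.

Lemma pose_repr_class (R : realType) (p : pose R) :
  pose_repr (pose_class p) = p \/ pose_repr (pose_class p) = flip p.
Proof.
case: p => x u; rewrite /pose_repr /pose_class /flip/=.
have : antipodal_equiv R (repr (\pi_(projline R) u)) u.
  by apply/eqmodP; rewrite -[LHS]/(\pi_(projline R) _) reprK.
by move=> /orP[]/eqP->; [left|right].
Qed.

Lemma class_minE (R : realType) (d : pose R -> pose R -> \bar R)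
    (p q : pose R) :
  class_min d (pose_class p) (pose_class q) =
  Order.min (Order.min (d p q) (d p (flip q)))
            (Order.min (d (flip p) q) (d (flip p) (flip q))).
Proof.
rewrite /class_min.
have [->|->] := pose_repr_class p; have [->|->] := pose_repr_class q;
  rewrite ?flipK //.
- by congr Order.min; rewrite minC.
- by rewrite minC.
- by rewrite minC; congr Order.min; rewrite minC.
Qed.

Lemma direction_surj (R : realType) (u : circle R) :
  exists theta, \val u = direction theta.
Proof.
have := valP u; rewrite inE/= dotE -!expr2; set a := _ 0 0; set b := _ 0 1 => ab.
have a1 : -1 <= a <= 1 by apply/andP; split; nra.
have sE : sin (acos a) = `|b|.
  by rewrite sin_acos// -sqrtr_sqr; congr Num.sqrt; lra.
suff [theta ca sb] : exists2 theta, cos theta = a & sin theta = b.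
  exists theta; apply/rowP => i; rewrite !mxE; case: ifPn => [/eqP->//|].
  by case: i => [[|[|//]]]//= Hi _; rewrite sb /b; congr (\val u 0 _); apply/val_inj.
have [b0|b0] := leP 0 b.
  by exists (acos a); rewrite ?acosK// sE ger0_norm.
exists (- acos a); first by rewrite cosN acosK.
by rewrite sinN sE ltr0_norm// opprK.
Qed.

Lemma control3E (R : realType) (gamma : R -> pose R) (t : R) :
  derivable (heading gamma) t 1 ->
  let n := heading gamma in
  control3 gamma t =
    n t 0 0 * derive1 n t 0 1 - n t 0 1 * derive1 n t 0 0.
Proof.
move=> dn n.
have dni (i : 'I_2) : is_derive t 1 (fun s => n s 0 i) (derive1 n t 0 i).
  apply: DeriveDef; first exact: (derivable_mxP _ _ _).1.
  by rewrite derive1E derive_mx// mxE.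
have nn s : n s 0 0 ^+ 2 + n s 0 1 ^+ 2 = 1.
  by have := valP (gamma s).2; rewrite inE/= dotE -!expr2.
set w := RHS.
have uniq_w v (theta : R -> R) :
    (\forall s \near t, n s = direction (theta s)) ->
    is_derive t 1 theta v -> v = w.
  move=> nth dth.
  have nt : n t = direction (theta t) by exact: nbhs_singleton nth.
  have d0 : derive1 n t 0 0 = - sin (theta t) * v.
    rewrite -(@derive_val _ _ _ _ _ _ _ (dni 0)).
    rewrite (@near_eq_derive _ _ _ _ (cos \o theta)); last first.
      by apply: filterS nth => s ->; rewrite mxE.
    exact: derive_val.
  have d1 : derive1 n t 0 1 = cos (theta t) * v.
    rewrite -(@derive_val _ _ _ _ _ _ _ (dni 1)).
    rewrite (@near_eq_derive _ _ _ _ (sin \o theta)); last first.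
      by apply: filterS nth => s ->; rewrite mxE.
    exact: derive_val.
  rewrite /w d0 d1 nt !mxE/=.
  by rewrite -[LHS]mul1r -(cos2Dsin2 (theta t)); ring.
have [theta0 nt] := direction_surj (gamma t).2.
rewrite -/(heading gamma t) -/(n t) in nt.
pose c s := n t 0 0 * n s 0 0 + n t 0 1 * n s 0 1.
pose d s := n t 0 0 * n s 0 1 - n t 0 1 * n s 0 0.
have cd s : c s ^+ 2 + d s ^+ 2 = 1.
  transitivity ((n t 0 0 ^+ 2 + n t 0 1 ^+ 2) * (n s 0 0 ^+ 2 + n s 0 1 ^+ 2)).
    by rewrite /c /d; ring.
  by rewrite !nn mulr1.
have dc : derivable c t 1.
  by apply: derivableD; apply: derivableM => //; apply: (ex_derive (dni _)).
have ct : c t = 1 by rewrite /c -!expr2 nn.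
have c0 : \forall s \near t, 0 < c s.
  have : {for t, continuous c}.
    exact/differentiable_continuous/derivable1_diffP.
  by move=> /(cvgr_gt (c t)); apply; rewrite ct.
have dd : is_derive t 1 d w.
  have -> : d = (n t 0 0 \*: (fun s => n s 0 1)) -
                (n t 0 1 \*: (fun s => n s 0 0)) by [].
  by apply: is_deriveB; exact: is_deriveZ.
have d0 : d t = 0 by rewrite /d mulrC subrr.
pose theta s := theta0 + asin (d s).
have dtheta : is_derive t 1 theta w.
  have dasin : is_derive (d t) 1 (@asin R) 1.
    apply: (is_derive_eq (is_derive1_asin _)); rewrite d0.
      by apply/andP; split; lra.
    by rewrite expr0n subr0 sqrtr1 invr1.
  have := is_deriveD (is_derive_cst theta0 t 1) (is_derive1_comp dasin dd).
  by rewrite add0r mul1r.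
have nth : \forall s \near t, n s = direction (theta s).
  apply: filterS c0 => s c0.
  have ds : -1 <= d s <= 1 by have := cd s; nra.
  have cs : cos (asin (d s)) = c s.
    rewrite cos_asin// -(ger0_norm (ltW c0)) -sqrtr_sqr; congr Num.sqrt.
    by have := cd s; lra.
  have ss : sin (asin (d s)) = d s by rewrite asinK.
  have n0 : n t 0 0 = cos theta0 by rewrite nt mxE.
  have n1 : n t 0 1 = sin theta0 by rewrite nt mxE.
  apply/rowP => i; rewrite !mxE /theta cosD sinD cs ss -n0 -n1 /c /d.
  rewrite -[LHS]mul1r -(nn t); case: ifPn => [/eqP->|]; first by ring.
  case: i => [[|[|//]]]//= Hi _.
  rewrite (_ : Ordinal Hi = 1); first by ring.
  exact/val_inj.
rewrite /control3; case: xgetP => [v _ [th nth' dth]|/(_ w)].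
  exact: uniq_w dth.
by case; exists theta.
Qed.

(* Main.v *)
(* Finiteness: two poses are joined by rotating towards the target position,
   driving forward and rotating again, with constant controls on each piece.
   Lower bound: let P_y be the pose ((0, y), (1, 0)) with y <> 0. A forward
   curve from a pose in [P_y] to one in [p_0] whose heading kept a positive (or
   negative) first component n_0 could not change x_1 without changing x_0, so
   at some time n_0 vanishes or has the sign opposite to its initial one.
   Hence the heading turns by pi/2 before and by pi/2 after that time, or by pi
   altogether. Turning is measured by asin (r n_0) with r < 1, whose derivative
   is at most |u^3|; letting r tend to 1 gives length at least pi delta. *)

Require Import Defs.
From HB Require Import structures.
From mathcomp Require Import all_boot all_order all_algebra.
From mathcomp Require Import all_classical all_reals all_analysis.
From mathcomp Require Import measurable_realfun ring lra.

Import Order.TTheory GRing.Theory Num.Theory.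
Import numFieldNormedType.Exports.

Local Open Scope classical_set_scope.
Local Open Scope ring_scope.

Set Implicit Arguments.
Unset Strict Implicit.
Unset Printing Implicit Defensive.

(** * Integrals and one-variable calculus *)

(** The integral of a nonnegative function is a supremum over the simple functions below it, and a
    larger function has more of them. The integrand of [curve_length] can thus be bounded on either
    side without first proving it measurable. *)
Lemma le_ge0_integral d (T : measurableType d) (R : realType)
    (m : {measure set T -> \bar R}) (D : set T) (f1 f2 : T -> \bar R) :
  (forall x, D x -> 0 <= f1 x)%E -> (forall x, D x -> f1 x <= f2 x)%E ->
  (\int[m]_(x in D) f1 x <= \int[m]_(x in D) f2 x)%E.
Proof.
move=> f10 f12; rewrite !(integral_mkcond D).
have h10 x : (0 <= (f1 \_ D) x)%E by exact: erestrict_ge0.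
have h20 x : (0 <= (f2 \_ D) x)%E.
  by apply: erestrict_ge0 => // t Dt; exact: le_trans (f10 _ Dt) (f12 _ Dt).
rewrite !ge0_integralTE//; apply: ereal_sup_le => _ [h hf <-]; exists h => // x.
by apply: le_trans (hf x) _; exact: lee_restrict.
Qed.

(** Cutting at the points of [S] one by one leaves intervals whose interior avoids [S]. In the
    applications [S] holds the breakpoints of a curve, where derivatives may fail to exist. *)
Lemma interval_seq_ind (R : realType) (Q : R -> R -> Prop) :
    (forall a c b, a < c -> c < b -> Q a c -> Q c b -> Q a b) ->
  forall (S : seq R) (a b : R), a < b ->
    (forall a' b', a <= a' -> a' < b' -> b' <= b ->
      {in `]a', b'[, forall t, t \notin S} -> Q a' b') ->
  Q a b.
Proof.
move=> Qadd; elim=> [|c S IH] a b ab Q0; first exact: Q0.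
have [/andP[ac cb]|cab] := boolP (a < c < b).
  apply: (Qadd _ c) => //; apply: IH => // a' b' aa' ab' bb' nS;
    (apply: Q0 => //; first by lra) => t tab;
    rewrite inE negb_or nS// andbT;
    by move: tab; rewrite in_itv/=; apply: contraTneq => ->; apply/negP; lra.
apply: IH => // a' b' aa' ab' bb' nS; apply: Q0 => // t tab.
rewrite inE negb_or nS// andbT; move: tab; rewrite in_itv/=.
by apply: contraTneq => ->; move: cab; apply: contra; lra.
Qed.

Lemma within_continuous_le (R : realType) (f : R -> R) (a b r : R) : a < b ->
  {within `[a, b], continuous f} -> {in `]a, b[, forall t, f t <= r} ->
  {in `[a, b], forall t, f t <= r}.
Proof.
move=> ab /(continuous_within_itvP _ ab)[_ fa fb] fr t.
rewrite in_itv/= => /andP[].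
rewrite le_eqVlt => /predU1P[<- _|a_t].
  rewrite -(cvg_lim _ fa)//; apply: limr_le.
    by apply/cvg_ex; exists (f a).
  near=> x; apply: fr; rewrite in_itv/=; apply/andP; split.
    by near: x; exact: nbhs_right_gt.
  by near: x; exact: nbhs_right_lt.
rewrite le_eqVlt => /predU1P[->|tb]; last by apply: fr; rewrite in_itv/= a_t.
rewrite -(cvg_lim _ fb)//; apply: limr_le; first by apply/cvg_ex; exists (f b).
near=> x; apply: fr; rewrite in_itv/=; apply/andP; split.
  by near: x; exact: nbhs_left_gt.
by near: x; exact: nbhs_left_lt.
Unshelve. all: by end_near. Qed.

Lemma ge0_derive1_le_off (R : realType) (f : R -> R) (S : seq R) (a b : R) :
    a < b -> {within `[a, b], continuous f} ->
    {in `]a, b[, forall t, t \notin S -> derivable f t 1 /\ 0 <= derive1 f t} ->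
  f a <= f b.
Proof.
move=> ab cf df.
apply: (@interval_seq_ind R (fun a b => f a <= f b) _ S) => //.
  by move=> ? ? ? _ _; exact: le_trans.
move=> a' b' aa' ab' bb' nS.
have sub t : t \in `]a', b'[ -> t \in `]a, b[ by rewrite !in_itv/=; lra.
apply: (@ger0_derive1_le_cc _ f a' b').
- by move=> t tab; have [] := df _ (sub _ tab) (nS _ tab).
- by move=> t tab; have [] := df _ (sub _ tab) (nS _ tab).
- apply: continuous_subspaceW cf => t /=; rewrite !in_itv/=; lra.
- by rewrite in_itv/= lexx ltW.
- by rewrite in_itv/= lexx ltW.
- exact: ltW.
Qed.

(** Off the finite, hence closed and measurable, set [S] the function is continuous on an open set;
    on [S] it is the constant 0, and the two endpoints do not affect measurability. *)
Lemma measurable_norm_derive1_off (R : realType) (f : R -> R) (S : seq R)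
    (A B : R) :
    {in `]A, B[, forall t, t \notin S -> {for t, continuous (derive1 f)}} ->
  measurable_fun `[A, B] (fun t => if t \in S then 0 else `|derive1 f t|).
Proof.
move=> cf.
apply/measurable_fun_itv_bndo_bndcP/measurable_fun_itv_obnd_cbndP.
have mS : measurable [set` S].
  by exact (countable_measurable (@measurable_set1 R)
    (finite_set_countable (finite_seq S))).
rewrite -(setUIDK `]A, B[ [set` S]) setUC.
apply/measurable_funU; [exact: measurableD|exact: measurableI|split].
  apply: (eq_measurable_fun (fun t => `|derive1 f t|)).
    by move=> t; rewrite inE/= => -[_ /negP/negbTE ->].
  apply: open_continuous_measurable_fun.
    apply: openI; first exact: interval_open.
    apply: closed_openC.
    have /accessible_finite_set_closed : accessible_space R.
      exact/hausdorff_accessible/norm_hausdorff.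
    by apply; exact: finite_seq.
  move=> t; rewrite inE/= => -[tAB /negP tS].
  by apply: continuous_comp; [exact: cf|exact: norm_continuous].
apply: (eq_measurable_fun (fun _ : R => 0 : R)); last exact: measurable_cst.
by move=> t; rewrite inE/= => -[_ ->].
Qed.

(** The fundamental theorem of calculus between consecutive points of [S], summed by the triangle
    inequality. As [derive1 f] may behave badly near a point of [S], the theorem is applied strictly
    inside each gap, and continuity of [f] then reaches the ends. *)
Lemma variation_le_integral (R : realType) (f : R -> R) (S : seq R)
    (A B a b : R) :
    {within `[A, B], continuous f} ->
    {in `]A, B[, forall t, t \notin S ->
      derivable f t 1 /\ {for t, continuous (derive1 f)}} ->
    A <= a -> a < b -> b <= B ->
  (`|f b - f a|%:E <= \int[@lebesgue_measure R]_(t in `]a, b])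
      (if t \in S then 0 else `|derive1 f t|)%:E)%E.
Proof.
move=> cf df Aa ab bB.
pose H t : R := if t \in S then 0 else `|derive1 f t|.
have H0 t : 0 <= H t by rewrite /H; case: ifP.
have mH : measurable_fun `[A, B] H.
  by apply: measurable_norm_derive1_off => t tAB tS; have [] := df t tAB tS.
pose Q a b := A <= a -> b <= B ->
  (`|f b - f a|%:E <= \int[@lebesgue_measure R]_(t in `]a, b]) (H t)%:E)%E.
suff : Q a b by exact.
apply: (@interval_seq_ind R Q _ S) => //.
  move=> {Aa ab bB}a c {}b ac cb Qac Qcb Aa bB.
  (* Intervals open on the left and closed on the right meet in no point, so the integrals over the
     two pieces add up. *)
  rewrite (@itv_bndbnd_setU _ _ _ (BRight c))//=; last 2 first.
  - by rewrite bnd_simp ltW.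
  - by rewrite bnd_simp ltW.
  rewrite ge0_integral_setU//=.
  - apply: le_trans (leeD (Qac Aa _) (Qcb _ bB)); [|lra|lra].
    rewrite -EFinD lee_fin [leRHS]addrC.
    by have := ler_normD (f b - f c) (f c - f a); rewrite addrA subrK.
  - apply/measurable_EFinP; apply: measurable_funS mH => // t /=.
    by rewrite !in_itv/= => -[]; lra.
  - by move=> t _; rewrite lee_fin.
  - apply/disj_setPS => t [] /=; rewrite !in_itv/=; lra.
move=> a' b' aa' ab' bb' nS Aa' bB'.
set I := (X in (_ <= X)%E).
have sub t : t \in `]a', b'[ -> t \in `]A, B[ by rewrite !in_itv/=; lra.
have mid s t : a' < s -> s < t -> t < b' -> (`|f t - f s|%:E <= I)%E.
  move=> a's st tb'.
  have stab r : r \in `[s, t] -> r \in `]a', b'[ by rewrite !in_itv/=; lra.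
  have cfst : {within `[s, t], continuous f}.
    by apply: continuous_subspaceW cf => r /=; rewrite !in_itv/=; lra.
  have cdf : {within `[s, t], continuous (derive1 f)}.
    apply: continuous_in_subspaceT => r; rewrite inE/= => /stab rab.
    exact: (df r (sub _ rab) (nS _ rab)).2.
  have FTC : (\int[@lebesgue_measure R]_(r in `[s, t]) (derive1 f r)%:E =
      (f t)%:E - (f s)%:E)%E.
    apply: continuous_FTC2 => //.
    have [_ fs ft] := (continuous_within_itvP _ st).1 cfst.
    split => // r; rewrite in_itv/= => /andP[sr rt].
    have rab : r \in `]a', b'[ by apply: stab; rewrite in_itv/= !ltW.
    exact: (df r (sub _ rab) (nS _ rab)).1.
  have mdf : measurable_fun `[s, t] (derive1 f).
    by apply: subspace_continuous_measurable_fun.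
  rewrite -[leLHS]/(`|(f t - f s)%:E|)%E EFinB -FTC.
  apply: le_trans (le_abse_integral _ _ _) _ => //.
    exact/measurable_EFinP.
  apply: (@le_trans _ _ (\int[@lebesgue_measure R]_(r in `[s, t]) (H r)%:E)%E).
    apply: le_ge0_integral => r /= rst; first by rewrite lee_fin.
    by rewrite /H (negbTE (nS _ (stab _ rst))).
  apply: ge0_subset_integral => //.
  - apply/measurable_EFinP; apply: measurable_funS mH => // r /=.
    by rewrite !in_itv/=; lra.
  - by move=> r _; rewrite lee_fin.
  - by move=> r /stab /=; rewrite !in_itv/=; lra.
have cfab : {within `[a', b'], continuous f}.
  by apply: continuous_subspaceW cf => r /=; rewrite !in_itv/=; lra.
(* An infinite integral bounds anything; otherwise it is a real [r], and the bound by [r] on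
   interior pairs passes to the limit, first at the right end and then at the left end. *)
have : (0 <= I)%E by apply: integral_ge0 => r _; rewrite lee_fin.
case EI : I => [r| |//] _; last by rewrite leey.
rewrite lee_fin.
have incr s t : a' < s -> s < t -> t < b' -> `|f t - f s| <= r.
  by move=> a's st tb; rewrite -lee_fin -EI; exact: mid.
have dist_c u : {within `[a', b'], continuous (fun t => `|f t - u|)}.
  move=> t; apply: (@continuous_comp (subspace `[a', b']) R R
    (fun t => f t - u) Num.norm t).
    apply: (@continuousB _ _ (subspace `[a', b']) f (cst u)); first exact: cfab.
    exact: cst_continuous.
  exact: norm_continuous.
have half s : a' < s -> s < b' -> `|f b' - f s| <= r.
  move=> a's sb.
  apply: (@within_continuous_le _ (fun t => `|f t - f s|) s b') => //.
  - by apply: continuous_subspaceW (dist_c _) => t /=; rewrite !in_itv/=; lra.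
  - by move=> t; rewrite in_itv/= => /andP[]; exact: incr.
  - by rewrite in_itv/= lexx ltW.
rewrite distrC.
apply: (@within_continuous_le _ (fun t => `|f t - f b'|) a' b') => //.
- by move=> t; rewrite in_itv/= => /andP[]; rewrite distrC; exact: half.
- by rewrite in_itv/= lexx ltW.
Qed.

(** * Piecewise C1 curves *)

Lemma itv_partition_mem_gap (R : realType) (a b t : R) (s : seq R) :
    itv_partition a b s -> t \in `]a, b[ -> t \notin s ->
  exists2 i, (i < size s)%N &
    t \in `]nth b (a :: s) i, nth b (a :: s) i.+1[.
Proof.
elim: s a => [|x s IH] a.
  by move=> /itv_partition_nil ->; rewrite in_itv/=; lra.
move=> abs; rewrite in_itv/= inE negb_or => /andP[at_ tb] /andP[tx ts].
have [ltx|xt] := ltP t x; first by exists 0%N => //=; rewrite in_itv/= at_.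
have [|i si ti] := IH x (itv_partition_cons abs) _ ts; last by exists i.+1.
by rewrite in_itv/= tb andbT lt_neqAle eq_sym tx.
Qed.

(** A pointwise form of smoothness for points off the breakpoints. Derivability is asked nearby, so
    that [derive1 f] agrees with an explicit formula on a neighbourhood and inherits its
    continuity. *)
Definition C1_near (R : realType) (V : normedModType R) (f : R -> V) (t : R) :=
  (\forall s \near t, derivable f s 1) /\ {for t, continuous (derive1 f)}.

Lemma C1_near_derivable (R : realType) (V : normedModType R) (f : R -> V)
    (t : R) : C1_near f t -> derivable f t 1.
Proof. by move=> [df _]; exact: nbhs_singleton df. Qed.

Lemma C1_near_continuous (R : realType) (f : R -> R) (t : R) :
  C1_near f t -> {for t, continuous f}.
Proof.
move=> /C1_near_derivable df.
exact/differentiable_continuous/derivable1_diffP.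
Qed.

Lemma C1_near_deriveP (R : realType) (V : normedModType R) (f g : R -> V)
    (t : R) :
    (\forall s \near t, is_derive (s : R) (1 : R) f (g s)) ->
    {for t, continuous g} ->
  C1_near f t.
Proof.
move=> df cg; split; first by apply: filterS df => s [].
have gf : \forall s \near t, g s = derive1 f s.
  by apply: filterS df => s [_ <-]; rewrite derive1E.
have gt : g t = derive1 f t by exact: nbhs_singleton gf.
change (derive1 f s @[s --> t] --> derive1 f t); rewrite -gt.
by apply: cvg_trans cg; exact: near_eq_cvg.
Qed.

Lemma C1_on_near (R : realType) (V : normedModType R)
    (f : R -> V) (a b t : R) :
  C1_on f a b -> t \in `]a, b[ -> C1_near f t.
Proof.
move=> [_ [g cg df]] tab; apply: (@C1_near_deriveP _ _ _ g).
  by apply: filterS (near_in_itvoo tab) => s; exact: df.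
apply: (@within_continuous_continuous _ _ _ a b) => //.
by move: tab; rewrite in_itv/= => /andP[]; exact: lt_trans.
Qed.

Lemma piecewise_C1_off (R : realType) (gamma : R -> pose R) :
    piecewise_C1 gamma ->
  exists S : seq R, {in `]0, 1[, forall t, t \notin S ->
    C1_near (fun t => (gamma t).1) t /\ C1_near (heading gamma) t}.
Proof.
move=> [_ [s ps C1s]]; exists s => t t01 ts.
have [i si ti] := itv_partition_mem_gap ps t01 ts.
have [Cx Cn] := C1s i si.
by split; [exact: C1_on_near Cx ti|exact: C1_on_near Cn ti].
Qed.

Lemma C1_near_coord (R : realType) (v : R -> 'rV[R]_2) (i : 'I_2) (t : R) :
  C1_near v t -> C1_near (fun s => v s 0 i) t.
Proof.
move=> [dv cv]; apply: (@C1_near_deriveP _ _ _ (fun s => derive1 v s 0 i)).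
  apply: filterS dv => s ds; apply: DeriveDef.
    exact: (derivable_mxP _ _ _).1.
  by rewrite derive1E derive_mx// mxE.
apply: (@continuous_comp _ _ _ _ (fun u : 'rV[R]_2 => u 0 i)) => //.
exact: coord_continuous.
Qed.

Lemma derive1_coord (R : realType) (v : R -> 'rV[R]_2) (i : 'I_2) (t : R) :
  derivable v t 1 -> derive1 (fun s => v s 0 i) t = derive1 v t 0 i.
Proof. by move=> dv; rewrite !derive1E derive_mx// mxE. Qed.

(** * Turning measured by the arcsine of a scaled coordinate *)

Section asin_scale.
Variables (R : realType) (r : R) (u : R -> R).
Hypotheses (r01 : 0 <= r < 1) (u1 : forall s, `|u s| <= 1).

(** The strict bound [r < 1] keeps the argument away from -1 and 1, where [asin] is not
    differentiable; a heading along the first axis does reach these values. *)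
Let ru s : -1 < r * u s < 1.
Proof.
rewrite -ltr_norml normrM; have /andP[r0 r1] := r01.
by rewrite ger0_norm//; apply: le_lt_trans r1; rewrite ler_piMr.
Qed.

Let D s := r * derive1 u s * (Num.sqrt (1 - (r * u s) ^+ 2))^-1.

Lemma is_derive_asin_scale (s : R) : derivable u s 1 ->
  is_derive s 1 (fun s => asin (r * u s)) (D s).
Proof.
move=> du.
have dru : is_derive s 1 (fun s => r * u s) (r * derive1 u s).
  rewrite derive1E; apply: (@is_deriveZ _ _ _ u).
  exact: derivableP.
have /= := @is_derive1_comp _ asin (fun s => r * u s) _ _ _
  (is_derive1_asin (ru s)) dru.
by rewrite /D mulrC.
Qed.

Lemma C1_near_asin_scale (t : R) :
  C1_near u t -> C1_near (fun s => asin (r * u s)) t.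
Proof.
move=> ut; have [du cdu] := ut; apply: (@C1_near_deriveP _ _ _ D).
  by apply: filterS du => s; exact: is_derive_asin_scale.
have cru : {for t, continuous (fun s => r * u s)}.
  by apply: continuousM; [exact: cst_continuous|exact: C1_near_continuous].
rewrite /D; apply: continuousM.
  by apply: continuousM => //; exact: cst_continuous.
apply: continuousV.
  rewrite gt_eqF// sqrtr_gt0 subr_gt0.
  by have /andP[] := ru t; nra.
apply: (@continuous_comp _ _ _ (fun s => 1 - (r * u s) ^+ 2) Num.sqrt).
  apply: continuousB; first exact: cst_continuous.
  by apply: continuousM; exact: cru.
exact: sqrt_continuous.
Qed.

End asin_scale.

(** The variation is counted before and after an intermediate time [c], since a function that
    returns to its initial value has no net variation. *)
Lemma variation2_le_integral (R : realType) (f : R -> R) (S : seq R)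
    (A B c : R) :
    {within `[A, B], continuous f} ->
    {in `]A, B[, forall t, t \notin S -> C1_near f t} -> A <= c <= B ->
  ((`|f c - f A| + `|f B - f c|)%:E <=
    \int[@lebesgue_measure R]_(t in `[A, B])
      (if t \in S then 0 else `|derive1 f t|)%:E)%E.
Proof.
move=> cf C1f /andP[Ac cB].
have df : {in `]A, B[, forall t, t \notin S ->
    derivable f t 1 /\ {for t, continuous (derive1 f)}}.
  by move=> t tAB /(C1f t tAB) ft; split; [exact: C1_near_derivable|case: ft].
have le_int a b : A <= a -> a <= b -> b <= B ->
    (`|f b - f a|%:E <= \int[@lebesgue_measure R]_(t in `]a, b])
      (if t \in S then 0 else `|derive1 f t|)%:E)%E.
  (* The time [c] may be an endpoint; one of the two pieces is then empty and contributes nothing on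
     either side. *)
  move=> Aa; rewrite le_eqVlt => /predU1P[<- _|ab bB].
    rewrite subrr normr0; apply: integral_ge0 => t _.
    by rewrite lee_fin; case: ifP.
  exact: variation_le_integral cf df Aa ab bB.
have mH : measurable_fun `[A, B]
    (fun t => if t \in S then 0 else `|derive1 f t|).
  by apply: measurable_norm_derive1_off => t tAB tS; have [] := df t tAB tS.
rewrite -integral_itv_obnd_cbnd; last first.
  apply/measurable_EFinP; apply: measurable_funS mH => // t /=.
  by rewrite !in_itv/=; lra.
rewrite (@itv_bndbnd_setU _ _ _ (BRight c))//= ge0_integral_setU//=.
- by rewrite EFinD; apply: leeD; apply: le_int.
- apply/measurable_EFinP; apply: measurable_funS mH => // t /=.
  by rewrite !in_itv/= => -[]; lra.
- by move=> t _; rewrite lee_fin; case: ifP.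
- by apply/disj_setPS => t [] /=; rewrite !in_itv/=; lra.
Qed.

Lemma heading_sqr (R : realType) (gamma : R -> pose R) (t : R) :
  heading gamma t 0 0 ^+ 2 + heading gamma t 0 1 ^+ 2 = 1.
Proof. by have := valP (gamma t).2; rewrite inE/= dotE -!expr2. Qed.

Lemma heading_le1 (R : realType) (gamma : R -> pose R) (t : R) (i : 'I_2) :
  `|heading gamma t 0 i| <= 1.
Proof.
suff: heading gamma t 0 i ^+ 2 <= 1.
  by rewrite ler_norml => ?; apply/andP; split; nra.
have := heading_sqr gamma t.
set a := heading gamma t 0 0; set b := heading gamma t 0 1.
have [->|->] : i = 0 \/ i = 1.
  by case: i => [[|[|//]]] Hi; [left|right]; exact/val_inj.
- by rewrite -/a; nra.
- by rewrite -/b; nra.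
Qed.

(** Differentiating the constant squared norm of the heading shows that its derivative is orthogonal
    to it, hence equal to [control3] times the heading rotated by a quarter turn; this is the first
    coordinate. *)
Lemma derive1_heading_control3 (R : realType) (gamma : R -> pose R) (t : R) :
  derivable (heading gamma) t 1 ->
  derive1 (heading gamma) t 0 0 = - heading gamma t 0 1 * control3 gamma t.
Proof.
move=> dn; rewrite control3E//; set n' := derive1 (heading gamma) t.
have dni i : is_derive t 1 (fun s => heading gamma s 0 i) (n' 0 i).
  apply: DeriveDef; first exact: (derivable_mxP _ _ _).1.
  by rewrite -derive1E derive1_coord.
have := heading_sqr gamma t.
set a := heading gamma t 0 0; set b := heading gamma t 0 1.
have := is_deriveD (is_deriveM (dni 0) (dni 0)) (is_deriveM (dni 1) (dni 1)).
rewrite (_ : _ + _ = cst 1); last first.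
  by apply/funext => s; rewrite /= -(heading_sqr gamma s) !expr2.
move=> /@derive_val; rewrite derive_cst /GRing.scale/= -/a -/b => ab0 ab1.
have ab' : a * n' 0 0 + b * n' 0 1 = 0 by lra.
transitivity ((a ^+ 2 + b ^+ 2) * n' 0 0 - a * (a * n' 0 0 + b * n' 0 1)).
  by rewrite ab' ab1 mul1r mulr0 subr0.
by ring.
Qed.

(** For a heading [(a, b)] the derivative has absolute value [r * |b| * |control3|] over the square
    root of [1 - (r * a) ^+ 2]. That root is at least [|b|], the square root of [1 - a ^+ 2], so the
    quotient is at most [|control3|]. *)
Lemma derive1_asin_heading_le (R : realType) (r : R) (gamma : R -> pose R)
    (t : R) : 0 <= r < 1 -> derivable (heading gamma) t 1 ->
  `|derive1 (fun s => asin (r * heading gamma s 0 0)) t| <= `|control3 gamma t|.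
Proof.
move=> r01 dn.
have dn0 : derivable (fun s => heading gamma s 0 0) t 1.
  exact: (derivable_mxP _ _ _).1.
have [_] := is_derive_asin_scale r01 (fun s => heading_le1 gamma s 0) dn0.
rewrite -derive1E => ->; rewrite derive1_coord// derive1_heading_control3//.
have := heading_sqr gamma t.
set a := heading gamma t 0 0; set b := heading gamma t 0 1 => ab.
have ra : (r * a) ^+ 2 <= a ^+ 2 by rewrite exprMn ler_piMl ?sqr_ge0//; nra.
have b_le : `|b| <= Num.sqrt (1 - (r * a) ^+ 2).
  by rewrite -sqrtr_sqr ler_wsqrtr//; lra.
have sq0 : 0 < 1 - (r * a) ^+ 2 by nra.
have sq : 0 < Num.sqrt (1 - (r * a) ^+ 2) by rewrite sqrtr_gt0.
rewrite !normrM normfV (gtr0_norm sq) ler_pdivrMr// normrN mulrA mulrC.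
rewrite ler_wpM2l// (le_trans _ b_le)// ger0_norm; last lra.
by rewrite ler_piMl//; lra.
Qed.

(** * Lower bound on the length of forward curves *)

Lemma continuous_pose_position (R : realType) :
  continuous (fun p : pose R => p.1).
Proof. by move=> p; exact: cvg_fst. Qed.

Lemma continuous_pose_heading (R : realType) :
  continuous (fun p : pose R => \val p.2).
Proof.
move=> p; apply: (@continuous_comp _ _ _ snd (fun u : circle R => \val u)).
  exact: cvg_snd.
exact: initial_continuous.
Qed.

Lemma curve_coord_continuous (R : realType) (gamma : R -> pose R) (i : 'I_2) :
    piecewise_C1 gamma ->
  {within `[0, 1], continuous (fun t => (gamma t).1 0 i)} /\
  {within `[0, 1], continuous (fun t => heading gamma t 0 i)}.
Proof.
move=> [cg _]; split.
  apply: (@within_continuous_comp _ _ _ _ gamma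
    (fun p : pose R => p.1 0 i)) => //.
  move=> p _; apply: (@continuous_comp _ _ _ (fun p : pose R => p.1)
    (fun v : 'rV[R]_2 => v 0 i)).
    exact: continuous_pose_position.
  exact: coord_continuous.
apply: (@within_continuous_comp _ _ _ _ gamma
  (fun p : pose R => \val p.2 0 i)) => //.
move=> p _; apply: (@continuous_comp _ _ _ (fun p : pose R => \val p.2)
  (fun v : 'rV[R]_2 => v 0 i)).
  exact: continuous_pose_heading.
exact: coord_continuous.
Qed.

(** At [r = 1] this is the signed angle between the heading and the second axis; smaller [r] gives a
    smooth approximation of it. *)
Definition scaled_angle (R : realType) (r : R) (gamma : R -> pose R) (t : R) :=
  asin (r * heading gamma t 0 0).

(** In the length integrand the cost is at least [delta] and the square root is at least
    [|control3|], which dominates the derivative of the scaled angle. Integration bounds the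
    variation. *)
Lemma curve_length_ge_scaled_angle (R : realType) (xi delta r c : R)
    (C : pose R -> R) (gamma : R -> pose R) :
    0 < delta -> (forall p, delta <= C p) -> piecewise_C1 gamma ->
    0 <= r < 1 -> 0 <= c <= 1 ->
  ((delta * (`|scaled_angle r gamma c - scaled_angle r gamma 0| +
             `|scaled_angle r gamma 1 - scaled_angle r gamma c|))%:E <=
    curve_length xi C gamma)%E.
Proof.
move=> d0 dC C1g r01 c01; set psi := scaled_angle r gamma.
have [S0 S0P] := piecewise_C1_off C1g.
(* With 0 and 1 among the exceptional points, the integrands need a real comparison only at interior
   points where the heading is differentiable. *)
pose S := [:: 0, 1 & S0].
have cpsi : {within `[0, 1], continuous psi}.
  apply: (@within_continuous_comp _ _ _ _ (fun t => heading gamma t 0 0)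
    (fun u => asin (r * u))).
    move=> u /set_mem[t _ <-].
    apply: continuous_comp; last first.
      apply: continuous_asin; rewrite -ltr_norml normrM.
      have := heading_le1 gamma t 0; have /andP[r0 r1] := r01.
      by rewrite (ger0_norm r0) => h; apply: le_lt_trans r1; rewrite ler_piMr.
    by apply: continuousM; [exact: cst_continuous|exact: cvg_id].
  by have [] := curve_coord_continuous 0 C1g.
have C1psi : {in `](0 : R), 1[, forall t, t \notin S -> C1_near psi t}.
  move=> t t01; rewrite !inE !negb_or => /and3P[_ _ tS].
  apply: C1_near_asin_scale => //; first by move=> s; exact: heading_le1.
  by apply: C1_near_coord; have [] := S0P t t01 tS.
have mH : measurable_fun (`[0, 1] : set R)
    (fun t => if t \in S then 0 else `|derive1 psi t|).
  apply: measurable_norm_derive1_off => t t01 tS.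
  by have [] := C1psi t t01 tS.
rewrite EFinM.
apply: le_trans (lee_wpmul2l _ (variation2_le_integral cpsi C1psi c01)) _.
  by rewrite lee_fin ltW.
rewrite -ge0_integralZl_EFin//=; last 3 first.
- by move=> t _; rewrite lee_fin; case: ifP.
- exact/measurable_EFinP.
- exact: ltW.
apply: le_ge0_integral => t /=; rewrite in_itv/= => t01; rewrite -EFinM lee_fin.
  by apply: mulr_ge0; [exact: ltW|case: ifP].
have C0 : 0 <= C (gamma t) by exact: le_trans (ltW d0) (dC _).
have [tS|tS] := boolP (t \in S).
  by rewrite mulr0 mulr_ge0// sqrtr_ge0.
apply: ler_pM; [exact: ltW d0|exact: normr_ge0|exact: dC|].
have /and3P[t0 t1 tS0] : [&& t != 0, t != 1 & t \notin S0].
  by move: tS; rewrite !inE !negb_or.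
have t01' : t \in `]0, 1[.
  by rewrite in_itv/= !lt_neqAle eq_sym t0 t1 /=.
have [_ dn] := S0P t t01' tS0.
apply: le_trans (derive1_asin_heading_le r01 (C1_near_derivable dn)) _.
rewrite -[leLHS]normr_id -[leLHS]sqrtr_sqr ler_wsqrtr//.
by rewrite lerDr mulr_ge0// sqr_ge0.
Qed.

(** A negative value would persist on a ball by continuity, and a ball has positive measure, so it
    cannot lie in a null set. *)
Lemma ae_ge0_continuous (R : realType) (a b t : R) (g : R -> R) :
    {ae @lebesgue_measure R, forall s : R, s \in `[a, b] -> 0 <= g s} ->
    t \in `]a, b[ -> {for t, continuous g} ->
  0 <= g t.
Proof.
move=> [N [mN N0 subN]] tab cg; rewrite leNgt; apply/negP => gt0.
have : \forall s \near t, g s < 0 /\ s \in `]a, b[.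
  near=> s; split; last by near: s; exact: near_in_itvoo.
  by near: s; apply: (@cvgr_lt _ _ _ _ g _ cg).
move=> /nbhs_ballP[e /= e0 ballP].
have ballN : ball t e `<=` N.
  move=> s /ballP[gs0]; rewrite in_itv/= => /andP[a_s sb].
  apply: subN => /= gs.
  have : 0 <= g s by apply: gs; rewrite in_itv/= !ltW.
  by rewrite leNgt gs0.
have : (@lebesgue_measure R (ball t e) <= @lebesgue_measure R N)%E.
  by apply: le_measure => //; rewrite inE//; exact: measurable_ball.
rewrite N0 (lebesgue_measure_ball _ (ltW e0)) -[0%E]/(0%R%:E) lee_fin mulr2n.
by move: e0; lra.
Unshelve. all: by end_near. Qed.

(* With m the minimum of s n_0, both s x_0 + m x_1 and s x_0 - m x_1 are
   nondecreasing along the curve. *)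
Lemma forward_curve_no_lateral_shift (R : realType) (s : R) (p q : pose R)
    (gamma : R -> pose R) :
    admissible_forward p q gamma -> s ^+ 2 = 1 ->
    {in `[0, 1], forall t, 0 < s * heading gamma t 0 0} ->
    p.1 0 0 = q.1 0 0 ->
  p.1 0 1 = q.1 0 1.
Proof.
move=> [[C1g g0 g1 span] fwd] s1 n_gt0 pq.
have [_ cn0] := curve_coord_continuous 0 C1g.
have csn0 : {within `[0, 1], continuous (fun t => s * heading gamma t 0 0)}.
  apply: (@within_continuous_comp _ _ _ _ (fun t => heading gamma t 0 0)
    (fun u => s * u)) => // u _.
  by apply: continuousM; [exact: cst_continuous|exact: cvg_id].
have [c c01 cmin] := EVT_min ler01 csn0.
pose m := s * heading gamma c 0 0.
have m0 : 0 < m by exact: n_gt0.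
have [S SP] := piecewise_C1_off C1g.
(* The sign [tau] treats the two monotone combinations at once. *)
have mono tau : tau ^+ 2 = 1 ->
    s * p.1 0 0 + m * tau * p.1 0 1 <= s * q.1 0 0 + m * tau * q.1 0 1.
  move=> tau1.
  pose F t := s * (gamma t).1 0 0 + m * tau * (gamma t).1 0 1.
  pose G t := s * velocity gamma t 0 0 + m * tau * velocity gamma t 0 1.
  have cF : {within `[0, 1], continuous F}.
    apply: (@within_continuous_comp _ _ _ _ gamma
      (fun p : pose R => s * p.1 0 0 + m * tau * p.1 0 1)); last by case: C1g.
    have cco (i : 'I_2) : continuous (fun p : pose R => p.1 0 i).
      move=> u; apply: (@continuous_comp _ _ _ (fun p : pose R => p.1)
        (fun v : 'rV[R]_2 => v 0 i)); first exact: continuous_pose_position.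
      exact: coord_continuous.
    move=> u _.
    apply: (@continuousD _ R _ (fun p : pose R => s * p.1 0 0)
      (fun p : pose R => m * tau * p.1 0 1));
      by apply: continuousM; [exact: cst_continuous|exact: cco].
  have GP : {ae @lebesgue_measure R, forall t : R, t \in `[0, 1] -> 0 <= G t}.
    have aeF := ae_filter_ringOfSetsType (@lebesgue_measure R).
    apply: (@filterS2 _ _ aeF _ _ _ _ span fwd) => t vt ft t01.
    have [k vk] := vlineP _ _ (vt t01).
    have := ft t01; rewrite /G vk dotE !mxE.
    have := heading_sqr gamma t; have := heading_le1 gamma t 1.
    have := cmin t t01; rewrite -/m.
    set a := heading gamma t 0 0; set b := heading gamma t 0 1.
    rewrite ler_norml => ma /andP[b1 b2] ab.
    have -> : k * a * a + k * b * b = k.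
      by rewrite -!mulrA -mulrDr -!expr2 ab mulr1.
    move=> k0.
    (* Here the velocity is [k] times the heading [(a, b)] with [0 <= k]. Since [s * a] is at least
       the minimum [m] and [tau * b] is at least -1, the bracket is nonnegative. *)
    have -> : s * (k * a) + m * tau * (k * b) =
        k * (s * a + m * (tau * b)) by ring.
    apply: mulr_ge0 => //.
    have : -1 <= tau * b by nra.
    by nra.
  have := @ge0_derive1_le_off R F S 0 1 ltr01 cF.
  rewrite /F g0 g1; apply => t t01 tS.
  have [xt _] := SP t t01 tS.
  have dx := C1_near_derivable xt.
  have dxi i : is_derive t 1 (fun r => (gamma r).1 0 i) (velocity gamma t 0 i).
    apply: DeriveDef; first exact: (derivable_mxP _ _ _).1.
    by rewrite -derive1E derive1_coord.
  have dF : is_derive t 1 F (G t).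
    by apply: is_deriveD; apply: is_deriveZ.
  split; first by case: dF.
  rewrite derive1E (@derive_val _ _ _ _ _ _ _ dF).
  (* The velocity is continuous off the breakpoints, so the sign known almost everywhere holds at
     every such point. *)
  apply: (ae_ge0_continuous GP t01).
  have cv i : {for t, continuous (fun r => velocity gamma r 0 i)}.
    apply: (@continuous_comp _ _ _ _ (fun u : 'rV[R]_2 => u 0 i)).
      by case: xt.
    exact: coord_continuous.
  by apply: continuousD; apply: continuousM => //; exact: cst_continuous.
(* The first coordinates agree at both ends, so the two signs give opposite inequalities between the
   second coordinates. *)
have := mono 1; have := mono (-1).
rewrite pq !mulr1 sqrrN expr1n => /(_ erefl) + /(_ erefl) => h1 h2.
apply/eqP; rewrite eq_le.
by apply/andP; split; rewrite -(ler_pM2l m0); lra.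
Qed.

Lemma asin_le0 (R : realType) (x : R) : -1 <= x <= 0 -> asin x <= 0.
Proof.
move=> /andP[x1 x0].
have xB : -1 <= x <= 1 by rewrite x1 (le_trans x0).
have p0 := pi_gt0 R; have pi2 := asin_lepi2 xB.
rewrite leNgt; apply/negP => h.
have : 0 < sin (asin x) by apply: sin_gt0_pi; lra.
by rewrite asinK ?in_itv//= ltNge x0.
Qed.

Lemma asinN (R : realType) (x : R) : -1 <= x <= 1 -> asin (- x) = - asin x.
Proof.
move=> xB; have xN : -1 <= - x <= 1 by move: xB; lra.
rewrite -{1}(asinK (x := x)) ?in_itv// -sinN sinK// in_itv/=.
by have := asin_geNpi2 xB; have := asin_lepi2 xB; lra.
Qed.

(** The sideways displacement forces a time [c] at which the first heading coordinate vanishes or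
    has the sign opposite to its initial one. If the final sign equals the initial one, the angle
    covers at least [phi] on each side of [c]; if not, the net change is already [2 * phi]. *)
Lemma forward_turn_ge_pi (R : realType) (p q : pose R) (gamma : R -> pose R)
    (phi : R) :
    admissible_forward p q gamma ->
    (\val p.2 0 0) ^+ 2 = 1 -> (\val q.2 0 0) ^+ 2 = 1 ->
    p.1 0 0 = q.1 0 0 -> p.1 0 1 != q.1 0 1 -> 0 <= phi < pi / 2 ->
  exists2 c, 0 <= c <= 1 & let psi := scaled_angle (sin phi) gamma in
    2 * phi <= `|psi c - psi 0| + `|psi 1 - psi c|.
Proof.
move=> fwd p2 q2 pq0 pq1 phiB.
set s := \val p.2 0 0.
have [c c01 sc] : exists2 c, c \in `[0, 1] & s * heading gamma c 0 0 <= 0.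
  apply: contrapT => Nex; apply/negP: pq1; rewrite negbK; apply/eqP.
  apply: (forward_curve_no_lateral_shift fwd p2 _ pq0) => t t01.
  by rewrite ltNge; apply/negP => h; apply: Nex; exists t.
exists c; first by rewrite in_itv/= in c01.
move=> psi.
have [[_ g0 g1 _] _] := fwd.
have sphi : asin (sin phi) = phi by apply: sinK; rewrite in_itv/=; lra.
have sinB : 0 <= sin phi <= 1.
  by rewrite sin_le1 andbT; apply: sin_ge0_pi; have := pi_gt0 R; lra.
(* The scale [sin phi] is chosen so that the scaled angle at both ends is exactly [phi] up to
   sign. *)
have asinpm u : u ^+ 2 = 1 -> asin (sin phi * u) = u * phi.
  move/eqP; rewrite sqrf_eq1 => /orP[]/eqP->; rewrite ?mulr1 ?mul1r//.
  by rewrite mulrN1 asinN ?sphi ?mulN1r//; lra.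
have psi0 : psi 0 = s * phi by rewrite /psi /scaled_angle /heading g0 asinpm.
have psi1 : psi 1 = \val q.2 0 0 * phi.
  by rewrite /psi /scaled_angle /heading g1 asinpm.
have spsi : s * psi c <= 0.
  rewrite /psi /scaled_angle; move: sc; have := heading_le1 gamma c 0.
  rewrite ler_norml; set a := heading gamma c 0 0 => a1.
  move/eqP: p2; rewrite -/s sqrf_eq1.
  move=> /orP[]/eqP->; rewrite ?mul1r ?mulN1r => a0.
    by apply: asin_le0; apply/andP; split; nra.
  rewrite -asinN; last by apply/andP; split; nra.
  by apply: asin_le0; apply/andP; split; nra.
rewrite psi0 psi1.
have := ler_norm (psi c - s * phi); have := ler_norm (s * phi - psi c).
have := ler_norm (\val q.2 0 0 * phi - psi c).
have := ler_norm (psi c - \val q.2 0 0 * phi).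
rewrite ![`|_ - psi c|]distrC.
move: q2 p2 spsi => /eqP; rewrite sqrf_eq1 => /orP[]/eqP-> /eqP;
  by rewrite -/s sqrf_eq1 => /orP[]/eqP->; lra.
Qed.

(** The length is at least [2 * phi * delta] for every [phi] below [pi / 2], and these bounds have
    supremum [pi * delta]. *)
Lemma forward_curve_length_ge (R : realType) (xi delta : R) (C : pose R -> R)
    (p q : pose R) (gamma : R -> pose R) :
    0 < delta -> (forall p, delta <= C p) ->
    admissible_forward p q gamma ->
    (\val p.2 0 0) ^+ 2 = 1 -> (\val q.2 0 0) ^+ 2 = 1 ->
    p.1 0 0 = q.1 0 0 -> p.1 0 1 != q.1 0 1 ->
  ((pi * delta)%:E <= curve_length xi C gamma)%E.
Proof.
move=> d0 dC fwd p2 q2 pq0 pq1.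
have len phi : 0 <= phi < pi / 2 ->
    ((2 * phi * delta)%:E <= curve_length xi C gamma)%E.
  move=> phiB; have [c c01 turn] := forward_turn_ge_pi fwd p2 q2 pq0 pq1 phiB.
  have sinB : 0 <= sin phi < 1.
    have [/andP[phi0 phi2] p0] := (phiB, pi_gt0 R).
    rewrite sin_ge0_pi/=; last lra.
    have : 0 < cos phi by apply: cos_gt0_pihalf; lra.
    have := cos2Dsin2 phi; have := sin_le1 phi; nra.
  have [[C1g _ _ _] _] := fwd.
  apply: le_trans (curve_length_ge_scaled_angle xi d0 dC C1g sinB c01).
  by rewrite lee_fin mulrC ler_pM2l.
have p0 := pi_gt0 R.
have : (0 <= curve_length xi C gamma)%E.
  by apply: le_trans (len 0 _); [rewrite lee_fin; lra|lra].
case: (curve_length xi C gamma) len => [L len|_ _|_ //]; last by rewrite leey.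
rewrite !lee_fin => L0; rewrite leNgt; apply/negP => Ld.
have dn0 : delta != 0 by rewrite gt_eqF.
have L2 : L / (2 * delta) < pi / 2.
  by rewrite ltr_pdivrMr; [move: Ld; lra|lra].
have L20 : 0 <= L / (2 * delta) by apply: divr_ge0 => //; lra.
have uE : L / (2 * delta) * delta = L / 2 by field.
move: L2 L20 uE; set u := L / _ => L2 L20 uE.
(* The number [u] is the value of [phi] at which the bound equals the length [L]. If [u] were below
   [pi / 2], the midpoint between them would give a bound exceeding [L]. *)
have /len : 0 <= (u + pi / 2) / 2 < pi / 2 by lra.
rewrite lee_fin (_ : _ * delta = u * delta + pi / 2 * delta); last by field.
by rewrite uE; lra.
Qed.

Lemma dist_F0_forward_ge (R : realType) (xi delta : R) (C : pose R -> R)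
    (p q : pose R) :
    0 < delta -> (forall p, delta <= C p) ->
    (\val p.2 0 0) ^+ 2 = 1 -> (\val q.2 0 0) ^+ 2 = 1 ->
    p.1 0 0 = q.1 0 0 -> p.1 0 1 != q.1 0 1 ->
  ((pi * delta)%:E <= dist_F0_forward xi C p q)%E.
Proof.
move=> d0 dC p2 q2 pq0 pq1; apply: le_ereal_inf_tmp => _ [gamma fwd <-].
exact: forward_curve_length_ge fwd p2 q2 pq0 pq1.
Qed.

(** Every punctured neighbourhood of the reference class contains a pose shifted sideways by some
    nonzero [y], and the bound for such a pose does not depend on [y]. *)
Lemma limf_esup_dist_c_ge (R : realType) (xi delta : R) (C : pose R -> R) :
    0 < delta -> (forall p, delta <= C p) ->
  ((pi * delta)%:E <=
    limf_esup ((dist_c xi C)^~ (pose_class (reference_pose R)))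
      (pose_class (reference_pose R))^')%E.
Proof.
move=> d0 dC; set P0 := pose_class _; apply: le_ereal_inf_tmp => _ [A PA <-].
pose p (y : R) : pose R := (y *: delta_mx 0 1, (reference_pose R).2).
have p_cvg : pose_class (p y) @[y --> 0] --> P0.
  rewrite (_ : P0 = pose_class (p 0)); last first.
    by rewrite /P0 /pose_class /p/= scale0r.
  apply: (@cvg_pair _ _ _ _ (nbhs (0 *: delta_mx 0 1 : 'rV[R]_2))
    (nbhs ((pose_class (reference_pose R)).2))
    _ _ _ (fun y : R => y *: delta_mx 0 1)
    (fun=> (pose_class (reference_pose R)).2)); last exact: cvg_cst.
  exact: scalel_continuous.
have : \forall y \near (0 : R)^', A (pose_class (p y)).
  have : \forall y \near (0 : R),
      pose_class (p y) != P0 -> A (pose_class (p y)).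
    exact: p_cvg PA.
  move=> nA; apply: filterS nA => y + y0; apply.
  apply: contra_neq y0 => /(congr1 (fun P : projpose R => P.1 0 1)).
  by rewrite /P0 /pose_class /p/= !mxE/= mulr1.
move=> nA.
have [y [y0 Ay]] : exists y : R, y != 0 /\ A (pose_class (p y)).
  have : \forall y \near (0 : R)^', y != 0 /\ A (pose_class (p y)).
    by near=> y; split; near: y => //; exact: nbhs_dnbhs_neq.
  by move=> /filter_ex.
apply: le_trans (ereal_sup_ubound _); last first.
  by exists (pose_class (p y)); [exact: Ay|].
(* All four pairs of representatives have headings with first coordinate 1 or -1, so the same bound
   covers the whole minimum. *)
rewrite /= /dist_c class_minE !le_min.
have e2 : (delta_mx 0 0 : 'rV[R]_2) 0 0 ^+ 2 = 1 by rewrite mxE expr1n.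
have e2N : (- delta_mx 0 0 : 'rV[R]_2) 0 0 ^+ 2 = 1.
  by rewrite !mxE sqrrN expr1n.
have x0 : (p y).1 0 0 = (reference_pose R).1 0 0 by rewrite /= !mxE/= mulr0.
have x1 : (p y).1 0 1 != (reference_pose R).1 0 1 by rewrite /= !mxE/= mulr1.
by apply/andP; split; apply/andP; split; apply: dist_F0_forward_ge.
Unshelve. all: by end_near. Qed.

(** * Curves with piecewise constant controls *)

Lemma is_derive_rV2 (R : realType) (v : R -> 'rV[R]_2) (t : R) (w : 'rV[R]_2) :
  (forall i, is_derive t 1 (fun s => v s 0 i) (w 0 i)) -> is_derive t 1 v w.
Proof.
move=> dv.
have dvt : derivable v t 1.
  by apply/derivable_mxP => i j; rewrite ord1; have [] := dv j.
apply: DeriveDef => //; rewrite derive_mx//.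
by apply/matrixP => i j; rewrite mxE ord1; have [] := dv j.
Qed.

Lemma is_derive_affine (R : realType) (A B t : R) :
  is_derive t 1 (fun s => A * s + B) A.
Proof.
have := is_deriveD (is_deriveZ A (is_derive_id t 1)) (is_derive_cst B t 1).
by rewrite addr0 /GRing.scale/= mulr1.
Qed.

Lemma is_derive_direction_affine (R : realType) (A B t : R) :
  is_derive t 1 (fun s => direction (A * s + B))
    (\row_i (if i == 0 then - sin (A * t + B) * A else cos (A * t + B) * A)).
Proof.
apply: is_derive_rV2 => i; rewrite mxE.
have dA := is_derive_affine A B t.
case: ifPn => i0.
  rewrite (_ : (fun s => _) = cos \o (fun s => A * s + B)).
    exact: is_derive1_comp.
  by apply/funext => s; rewrite mxE i0.
rewrite (_ : (fun s => _) = sin \o (fun s => A * s + B)).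
  exact: is_derive1_comp.
by apply/funext => s; rewrite mxE (negbTE i0).
Qed.

Lemma is_derive_line (R : realType) (P V : 'rV[R]_2) (t : R) :
  is_derive t 1 (fun s : R => P + s *: V) V.
Proof.
apply: is_derive_rV2 => i.
rewrite (_ : (fun s => _) = (fun s => V 0 i * s + P 0 i)).
  exact: is_derive_affine.
by apply/funext => s; rewrite !mxE addrC mulrC.
Qed.

Lemma is_derive_continuous (R : realType) (V : normedModType R) (f g : R -> V) :
  (forall t : R, is_derive t (1 : R) f (g t)) -> continuous f.
Proof.
move=> df t; apply/differentiable_continuous/derivable1_diffP.
by have [] := df t.
Qed.

Lemma continuous_circle_point (R : realType) : continuous (@circle_point R).
Proof.
apply: continuous_comp_initial.
have := @is_derive_continuous _ _ (fun s : R => direction (1 * s + 0)) _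
  (is_derive_direction_affine 1 0).
by under eq_fun do rewrite mul1r addr0.
Qed.

(** Each piece of a curve is compared with a formula [h] smooth on the whole line, whose derivative
    supplies the continuous extension to the endpoints. *)
Lemma C1_on_eq (R : realType) (V : normedModType R) (f h g : R -> V) (a b : R) :
    {in `[a, b], f =1 h} ->
    (forall t : R, is_derive t (1 : R) h (g t)) -> continuous g ->
  C1_on f a b.
Proof.
move=> fh dh cg; split.
  apply: (@subspace_eq_continuous _ _ _ h).
    by move=> t; rewrite inE => tab; apply/esym/fh.
  by apply: continuous_subspaceT; exact: is_derive_continuous dh.
exists g; first exact: continuous_subspaceT.
move=> t tab; apply: near_eq_is_derive (dh t).
apply: filterS (near_in_itvoo tab) => s; rewrite in_itv/= => /andP[a_s sb].
by rewrite fh// in_itv/= !ltW.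
Qed.

(* Constant controls w and A: a rotation in place if w = 0, a forward straight
   line if A = 0. *)
Definition constant_control (R : realType) (gamma : R -> pose R)
    (w A a b : R) :=
  exists P V B,
    {in `[a, b], forall t, V = w *: direction (A * t + B) /\
      gamma t = (P + t *: V, circle_point (A * t + B))}.

Section constant_control.
Variables (R : realType) (gamma : R -> pose R) (w A a b : R).
Hypothesis ccg : constant_control gamma w A a b.

Lemma constant_control_C1 :
  C1_on (fun t => (gamma t).1) a b /\ C1_on (fun t => \val (gamma t).2) a b.
Proof.
have [P [V [B gE]]] := ccg; split.
  apply: (@C1_on_eq _ _ _ (fun t => P + t *: V) (fun=> V)).
  - by move=> t tab; have [_ ->] := gE t tab.
  - by move=> t; exact: is_derive_line.
  - exact: cst_continuous.
apply: (C1_on_eq _ (is_derive_direction_affine A B)).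
  by move=> t tab; have [_ ->] := gE t tab.
have cA : continuous (fun t : R => A * t + B).
  exact: is_derive_continuous (is_derive_affine A B).
(* The first derivative is continuous because it is itself differentiable; the function given here
   is the second derivative. *)
apply: (@is_derive_continuous _ _ _ (fun t => \row_i (if i == 0 then
  - cos (A * t + B) * A ^+ 2 else - sin (A * t + B) * A ^+ 2))) => t.
apply: is_derive_rV2 => i; rewrite mxE.
have dA := is_derive_affine A B t.
case: ifPn => i0.
  rewrite (_ : (fun s => _) = (- A) \*: (sin \o (fun s => A * s + B))).
    apply: is_derive_eq.
    by rewrite /GRing.scale/=; ring.
  by apply/funext => s; rewrite mxE i0 mulNr mulrC -mulNr.
rewrite (_ : (fun s => _) = A \*: (cos \o (fun s => A * s + B))).
  apply: is_derive_eq.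
  by rewrite /GRing.scale/=; ring.
by apply/funext => s; rewrite mxE (negbTE i0) mulrC.
Qed.

Lemma constant_control_velocity (t : R) : t \in `]a, b[ ->
  velocity gamma t = w *: heading gamma t.
Proof.
move=> tab; have [P [V [B gE]]] := ccg.
have gE' s : s \in `]a, b[ ->
    V = w *: direction (A * s + B) /\
    gamma s = (P + s *: V, circle_point (A * s + B)).
  by rewrite in_itv/= => /andP[a_s sb]; apply: gE; rewrite in_itv/= !ltW.
rewrite /velocity /heading (gE' t tab).2/= -(gE' t tab).1 derive1E.
rewrite (@near_eq_derive _ _ _ _ (fun s : R => P + s *: V)).
  by have [] := is_derive_line P V t.
by apply: filterS (near_in_itvoo tab) => s /gE'[_ ->].
Qed.

Lemma constant_control_control1 (t : R) : t \in `]a, b[ ->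
  control1 gamma t = w.
Proof.
move=> tab; rewrite /control1 constant_control_velocity// dotE !mxE.
by rewrite -!mulrA -mulrDr -!expr2 heading_sqr mulr1.
Qed.

Lemma constant_control_control3 (t : R) : t \in `]a, b[ ->
  control3 gamma t = A.
Proof.
move=> tab; have [P [V [B gE]]] := ccg.
have near_dir : \forall s \near t, direction (A * s + B) = heading gamma s.
  apply: filterS (near_in_itvoo tab) => s; rewrite in_itv/= => /andP[a_s sb].
  by rewrite /heading (gE s _).2// in_itv/= !ltW.
have dn := near_eq_is_derive near_dir (is_derive_direction_affine A B t).
rewrite control3E; last by case: dn.
rewrite derive1E (@derive_val _ _ _ _ _ _ _ dn).
rewrite -(nbhs_singleton near_dir) !mxE/=.
transitivity (A * (cos (A * t + B) ^+ 2 + sin (A * t + B) ^+ 2)); first by ring.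
by rewrite cos2Dsin2 mulr1.
Qed.

(** The square root is constant on the open piece, and the cost along the piece is a continuous
    function on a compact interval, so it attains a maximum. *)
Lemma constant_control_cost_bounded (C : pose R -> R) (xi : R) :
  a <= b -> C1_cost C ->
  exists M, {in `]a, b[, forall t, C (gamma t) *
    Num.sqrt (xi ^+ 2 * `|control1 gamma t| ^+ 2 + `|control3 gamma t| ^+ 2)
    <= M}.
Proof.
move=> ab [dC _]; have [P [V [B gE]]] := ccg.
pose c t := C (P + t *: V, circle_point (A * t + B)).
have cc : {within `[a, b], continuous c}.
  apply: continuous_subspaceT => t.
  apply: (@continuous_comp _ _ _ (fun t : R => (P + t *: V, A * t + B))
    (fun z : 'rV[R]_2 * R => C (z.1, circle_point z.2))).
    apply: (@cvg_pair _ _ _ _ (nbhs (P + t *: V)) (nbhs (A * t + B)) _ _ _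
      (fun t : R => P + t *: V) (fun t : R => A * t + B)).
      exact: (is_derive_continuous (is_derive_line P V)).
    exact: (is_derive_continuous (is_derive_affine A B)).
  exact: differentiable_continuous.
have [d dab cmax] := EVT_max ab cc.
exists (c d * Num.sqrt (xi ^+ 2 * `|w| ^+ 2 + `|A| ^+ 2)) => t tab.
rewrite constant_control_control1// constant_control_control3//.
have tab' : t \in `[a, b].
  by move: tab; rewrite !in_itv/= => /andP[? ?]; rewrite !ltW.
by rewrite ler_wpM2r ?sqrtr_ge0// (gE t tab').2; exact: cmax.
Qed.

End constant_control.

(** The bounds are given on open pieces only, since the controls are not known at the breakpoints;
    the finitely many values there enter the maximum separately. *)
Lemma itv_partition_bounded (R : realType) (f : R -> R) (a b : R) (s : seq R) :
    itv_partition a b s ->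
    (forall i, (i < size s)%N -> exists M,
      {in `]nth b (a :: s) i, nth b (a :: s) i.+1[, forall t, f t <= M}) ->
  exists M, {in `[a, b], forall t, f t <= M}.
Proof.
elim: s a => [|x s IH] a ps fM.
  exists (f a) => t; rewrite (itv_partition_nil ps) in_itv/= => tb.
  by rewrite (_ : t = b)//; lra.
have [M fMx] := fM 0%N isT.
have [N fN] := IH x (itv_partition_cons ps) (fun i => fM i.+1).
exists (Num.max (f a) (Num.max M N)) => t; rewrite in_itv/= => /andP[a_t tb].
rewrite !le_max; have [tx|xt] := ltP t x.
  move: a_t; rewrite le_eqVlt => /predU1P[->|a_t]; first by rewrite lexx.
  by rewrite fMx ?orbT// in_itv/= a_t.
by rewrite fN ?orbT// in_itv/= xt.
Qed.

(** The conditions on the velocity hold off the finitely many breakpoints, and the length is finite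
    because its integrand is bounded on the unit interval. *)
Lemma constant_control_curve (R : realType) (gamma : R -> pose R) (s : seq R)
    (xi : R) (C : pose R -> R) :
    continuous gamma -> itv_partition 0 1 s ->
    (forall i, (i < size s)%N -> exists w A, 0 <= w /\
      constant_control gamma w A (nth 1 (0 :: s) i) (nth 1 (0 :: s) i.+1)) ->
    C1_cost C -> (forall p, 0 <= C p) ->
  admissible_forward (gamma 0) (gamma 1) gamma /\
  (curve_length xi C gamma < +oo)%E.
Proof.
move=> cg ps pieces C1C C0.
have ae_piece (P : R -> Prop) :
    (forall a b w A t, 0 <= w -> constant_control gamma w A a b ->
      t \in `]a, b[ -> P t) ->
    {ae @lebesgue_measure R, forall t : R, t \in `[0, 1] -> P t}.
  (* This finite set contains both ends of the unit interval, as 1 is the last point of the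
     partition [s]. *)
  move=> Pt; exists [set` 0 :: s]; split.
  - exact (countable_measurable (@measurable_set1 R)
      (finite_set_countable (finite_seq (0 :: s)))).
  - exact/countable_lebesgue_measure0/finite_set_countable/finite_seq.
  move=> t /= nPt; apply: contrapT => /negP ts; apply: nPt.
  rewrite in_itv/= => /andP[t0 t1].
  have [_ /eqP last1] := ps.
  have t01 : t \in `]0, 1[.
    rewrite in_itv/= !lt_neqAle t0 t1 !andbT; apply/andP; split.
      by apply: contraNneq ts => <-; rewrite mem_head.
    by apply: contraNneq ts => ->; rewrite -last1 mem_last.
  have ts' : t \notin s by move: ts; rewrite inE negb_or => /andP[].
  have [i si ti] := itv_partition_mem_gap ps t01 ts'.
  have [w [A [w0 ccg]]] := pieces i si.
  exact: Pt w0 ccg ti.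
split; [split; [split|]|] => //.
- split; first exact: continuous_subspaceT.
  exists s => // i si; have [w [A [_ ccg]]] := pieces i si.
  exact: constant_control_C1 ccg.
- apply: ae_piece => a b w A t _ ccg tab.
  by rewrite (constant_control_velocity ccg tab) memvZ ?memv_line.
- apply: ae_piece => a b w A t w0 ccg tab.
  by have := constant_control_control1 ccg tab; rewrite /control1 => ->.
pose f t := C (gamma t) *
  Num.sqrt (xi ^+ 2 * `|control1 gamma t| ^+ 2 + `|control3 gamma t| ^+ 2).
have [|M fM] := @itv_partition_bounded _ f 0 1 s ps.
  move=> i si; have [w [A [_ ccg]]] := pieces i si.
  apply: (constant_control_cost_bounded ccg xi _ C1C).
  have [lt_s _] := ps; have := pathP 1 lt_s i si; exact: ltW.
have : (curve_length xi C gamma <=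
    \int[@lebesgue_measure R]_(t in `[0%R, 1%R]) (cst M%:E) t)%E.
  apply: le_ge0_integral => t t01 /=; rewrite lee_fin; last exact: fM.
  by rewrite mulr_ge0// sqrtr_ge0.
move=> /le_lt_trans; apply.
rewrite integral_cst//= lebesgue_measure_itv/= lte_fin ltr01.
by rewrite -EFinB -EFinM ltry.
Qed.

(** * Joining two poses by a rotation, a forward drive and a rotation *)

Lemma direction_scale_surj (R : realType) (v : 'rV[R]_2) :
  exists r theta, 0 <= r /\ v = r *: direction theta.
Proof.
have [v0|v0] := eqVneq (dot v v) 0.
  (* The zero vector has no direction of its own; radius 0 allows any angle, here 0. *)
  exists 0, 0; split => //; rewrite scale0r; move: v0; rewrite dotE => v0.
  apply/rowP => i; rewrite mxE.
  have [->|->] : i = 0 \/ i = 1.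
    by case: i => [[|[|//]]] Hi; [left|right]; exact/val_inj.
  - by nra.
  - by nra.
pose r := Num.sqrt (dot v v).
have vv0 : 0 < dot v v.
  by rewrite lt_neqAle eq_sym v0/= dotE -!expr2 addr_ge0 ?sqr_ge0.
have r0 : 0 < r by rewrite sqrtr_gt0.
have r2 : r ^+ 2 = dot v v by rewrite sqr_sqrtr// ltW.
have u1 : r^-1 *: v \in [set v : 'rV[R]_2 | dot v v = 1].
  rewrite inE/= dotE !mxE.
  have -> : r^-1 * v 0 0 * (r^-1 * v 0 0) + r^-1 * v 0 1 * (r^-1 * v 0 1) =
      (r ^+ 2)^-1 * dot v v by rewrite dotE; field; rewrite gt_eqF.
  by rewrite r2 mulVf.
have [theta vE] := direction_surj (SigSub u1 : circle R).
exists r, theta; split; first exact: ltW.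
by rewrite -vE/= scalerA mulfV ?scale1r// gt_eqF.
Qed.

(** Truncation of [t] to the unit interval, written with absolute values so that its continuity is
    immediate. *)
Definition ramp (R : realType) (t : R) : R := (`|t| - `|t - 1| + 1) / 2.

Lemma ramp_le0 (R : realType) (t : R) : t <= 0 -> ramp t = 0.
Proof. by move=> t0; rewrite /ramp !ler0_norm; lra. Qed.

Lemma ramp_id (R : realType) (t : R) : 0 <= t <= 1 -> ramp t = t.
Proof. by move=> t01; rewrite /ramp ger0_norm ?ler0_norm; lra. Qed.

Lemma ramp_ge1 (R : realType) (t : R) : 1 <= t -> ramp t = 1.
Proof. by move=> t1; rewrite /ramp !ger0_norm; lra. Qed.

Lemma continuous_ramp (R : realType) : continuous (@ramp R).
Proof.
rewrite -[@ramp R]/((fun t : R => `|t| - `|t - 1| + 1) \* cst 2^-1) => t.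
apply: continuousM; last exact: cst_continuous.
apply: (@continuousD _ R _ (fun t : R => `|t| - `|t - 1|) (cst 1));
  last exact: cst_continuous.
apply: (@continuousB _ R _ (fun t : R => `|t|) (fun t : R => `|t - 1|)).
  exact: norm_continuous.
apply: (@continuous_comp _ _ _ (fun t : R => t - 1) Num.norm).
  by apply: continuousB; [exact: cvg_id|exact: cst_continuous].
exact: norm_continuous.
Qed.

(** The heading turns from the initial angle [a] to the angle [c] of the displacement, the position
    moves along [c], and the heading turns on to the final angle [b], each during one third of the
    time. *)
Lemma rotate_drive_rotate (R : realType) (p q : pose R) :
  exists gamma : R -> pose R, [/\ continuous gamma, gamma 0 = p, gamma 1 = q &
    exists2 s, itv_partition 0 1 s &
      forall i, (i < size s)%N -> exists w A, 0 <= w /\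
        constant_control gamma w A (nth 1 (0 :: s) i) (nth 1 (0 :: s) i.+1)].
Proof.
case: p q => [x m] [y n].
have [a mE] := direction_surj m; have [b nE] := direction_surj n.
have [r [c [r0 rE]]] := direction_scale_surj (y - x).
(* For [j] equal to 0, 1 or 2, [k j] grows from 0 to 1 between [j / 3] and [(j + 1) / 3] and is
   constant elsewhere, so only one motion is active at a time. *)
pose k (j t : R) := ramp (3 * t - j).
have ck j : continuous (k j).
  rewrite -[k j]/(@ramp R \o (fun t : R => 3 * t + - j)) => t.
  apply: continuous_comp.
    exact: (is_derive_continuous (is_derive_affine 3 (- j))).
  exact: continuous_ramp.
pose theta t := (c - a) * k 0 t + a + (b - c) * k 2 t.
pose pos t := x + k 1 t *: (y - x).
exists (fun t => (pos t, circle_point (theta t))); split.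
- move=> t; apply: (@cvg_pair _ _ _ _
    (nbhs (pos t)) (nbhs (circle_point (theta t))) _ _ _ pos
    (fun t => circle_point (theta t))).
    apply: (@continuous_comp _ _ _ (k 1) (fun u : R => x + u *: (y - x))).
      exact: ck.
    exact: (is_derive_continuous (is_derive_line x (y - x))).
  apply: (@continuous_comp _ _ _ theta (@circle_point R)).
    apply: continuousD.
      apply: continuousD; last exact: cst_continuous.
      by apply: continuousM; [exact: cst_continuous|exact: ck].
    by apply: continuousM; [exact: cst_continuous|exact: ck].
  exact: continuous_circle_point.
- have k0 j : 0 <= j -> k j 0 = 0 by move=> j0; apply: ramp_le0; lra.
  rewrite /pos /theta !k0//.
  rewrite scale0r addr0 !mulr0 addr0 add0r; congr (_, _).
  by apply/val_inj; rewrite /= mE.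
- have k1 j : j <= 2 -> k j 1 = 1 by move=> j2; apply: ramp_ge1; lra.
  rewrite /pos /theta !k1 ?lexx ?ler1n ?ler0n//.
  rewrite scale1r addrC subrK; congr (_, _).
  by apply/val_inj; rewrite /= nE; congr direction; ring.
exists [:: 1 / 3; 2 / 3; 1].
  by split => //=; rewrite ?eqxx//; apply/and4P; split => //; lra.
case=> [|[|[|//]]] _ /=.
- exists 0, (3 * (c - a)); split => //; exists x, 0, a => t.
  rewrite in_itv/= => t01; rewrite scale0r scaler0 addr0; split => //.
  have -> : theta t = 3 * (c - a) * t + a.
    by rewrite /theta /k ramp_id ?ramp_le0; [ring|lra|lra].
  rewrite /pos /k ramp_le0; last lra.
  by rewrite scale0r addr0.
- exists (3 * r), 0; split; first lra.
  (* The position [x + (3 * t - 1) *: (y - x)] is rewritten as an affine function of [t], with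
     [y - x] equal to [r *: direction c]; [0 <= r] makes the drive forward. *)
  exists (x - r *: direction c), (3 * r *: direction c), c => t.
  rewrite in_itv/= => t01; rewrite mul0r add0r; split => //.
  have -> : theta t = c.
    by rewrite /theta /k ramp_ge1 ?ramp_le0; [ring|lra|lra].
  rewrite /pos /k rE ramp_id; last lra.
  by congr (_, _); apply/rowP => i; rewrite !mxE; ring.
- exists 0, (3 * (b - c)); split => //; exists y, 0, (c - 2 * (b - c)) => t.
  rewrite in_itv/= => t01; rewrite scale0r scaler0 addr0; split => //.
  have -> : theta t = 3 * (b - c) * t + (c - 2 * (b - c)).
    by rewrite /theta /k ramp_ge1 ?ramp_id; [ring|lra|lra].
  rewrite /pos /k ramp_ge1; last lra.
  by rewrite scale1r addrC subrK.
Qed.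

(** * Finiteness of the distances and the conclusion *)

Lemma dist_F0_forward_lty (R : realType) (xi : R) (C : pose R -> R)
    (p q : pose R) : C1_cost C -> (forall p, 0 <= C p) ->
  (dist_F0_forward xi C p q < +oo)%E.
Proof.
move=> C1C C0; have [gamma [cg <- <- [s ps pieces]]] := rotate_drive_rotate p q.
have [adm len] := constant_control_curve xi cg ps pieces C1C C0.
by apply: le_lt_trans len; apply: ereal_inf_lbound; exists gamma.
Qed.

Lemma dist_F0_le_forward (R : realType) (xi : R) (C : pose R -> R)
    (p q : pose R) : (dist_F0 xi C p q <= dist_F0_forward xi C p q)%E.
Proof. by apply: ereal_inf_le_tmp => _ [gamma [adm _] <-]; exists gamma. Qed.

Lemma dist_F0_ge0 (R : realType) (xi : R) (C : pose R -> R)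
    (p q : pose R) : (forall p, 0 <= C p) -> (0 <= dist_F0 xi C p q)%E.
Proof.
move=> C0; apply: le_ereal_inf_tmp => _ [gamma _ <-].
by apply: integral_ge0 => t _; rewrite lee_fin mulr_ge0// sqrtr_ge0.
Qed.

Lemma class_min_fin_num (R : realType) (d : pose R -> pose R -> \bar R) :
  (forall p q, d p q \is a fin_num) -> globally_controllable (class_min d).
Proof.
move=> dfin P Q.
have min_fin (x y : \bar R) :
    x \is a fin_num -> y \is a fin_num -> Order.min x y \is a fin_num.
  by move=> xfin yfin; rewrite /Order.min; case: ifP.
by apply: (min_fin _ _); apply: (min_fin _ _); exact: dfin.
Qed.

Unset Implicit Arguments.

Theorem proposition3 (R : realType) (xi delta : R) (C : pose R -> R)
    (hxi : 0 < xi) (hdelta : 0 < delta)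
    (hC : C1_cost C) (hCdelta : forall p, delta <= C p) :
  [/\ globally_controllable (dist_c xi C),
      globally_controllable (dist_proj xi C),
      ~ locally_controllable (dist_c xi C) (pose_class (reference_pose R)) &
      ((pi * delta)%:E <=
        limf_esup ((dist_c xi C)^~ (pose_class (reference_pose R)))
          (pose_class (reference_pose R))^')%E].
Proof.
have C0 p : 0 <= C p by exact: le_trans (ltW hdelta) (hCdelta p).
have limsup := limf_esup_dist_c_ge xi hdelta hCdelta.
split => //.
- apply: class_min_fin_num => p q.
  rewrite ge0_fin_numE ?dist_F0_forward_lty//.
  (* Forward curves are admissible, so their infimum lies above that over all admissible curves,
     which is nonnegative. *)
  exact: le_trans (dist_F0_ge0 xi p q C0) (dist_F0_le_forward xi C p q).
- apply: class_min_fin_num => p q.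
  rewrite ge0_fin_numE ?dist_F0_ge0//.
  apply: le_lt_trans (dist_F0_le_forward xi C p q) _.
  exact: dist_F0_forward_lty.
(* Local controllability would make the upper limit 0, below the positive number [pi * delta]. *)
- rewrite /locally_controllable => lim0.
  by move: limsup; rewrite lim0 lee_fin leNgt mulr_gt0// pi_gt0.
Qed.
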